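(* Let $G$ be a finitely generated group and let $S\subset G$ be a finite symmetric generating set of $G$. Let $\alpha\geq 0$ be a real number. For any finite non-empty subset $\Omega$ of $G$ such that $\Phi_S[(1+\alpha)|\Omega|]<\infty$ (which is always the case if $G$ is infinite), we have $$\frac{|\partial_S\Omega|}{|\Omega|}\geq\frac{\alpha}{1+\alpha}\,\frac{|B_S(r-1)|}{|B_S(r)|}\,\frac{1}{\mathbb E\left[|X_r|_S\right]},$$ where $r=\Phi_S[(1+\alpha)|\Omega|]$.
   Context: $|A|$ denotes the cardinality of a set $A$. For $x\in G$, the word norm is $|x|_S=\min\{n\ge 0:\exists g_1,\dots,g_n\in S,\ x=g_1\cdots g_n\}$ (the empty product is the identity $e$, so $|e|_S=0$), and $d_S(x,y)=|x^{-1}y|_S$. For real $r\ge 0$, $B_S(r)=\{x\in G:|x|_S\leq r\}$, and balls of negative radius are empty. The generalized inverse of the growth function is $\Phi_S[v]=\inf\{r:|B_S(r)|>v\}$ (the infimum of the empty set being $\infty$). The boundary of $\Omega\subset G$ is $\partial_S\Omega=\{x\in\Omega:\exists s\in S,\ xs\in G\setminus\Omega\}$. The average length of the elements of the ball of radius $r\geq 0$ is $\mathbb E\left[|X_r|_S\right]=\frac{1}{|B_S(r)|}\sum_{g\in B_S(r)}|g|_S$. *)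

(* Defs.v *)
From HB Require Import structures.
From mathcomp Require Import all_boot all_order all_algebra finmap.
From mathcomp Require Import all_classical all_reals ereal.

Set Implicit Arguments.
Unset Strict Implicit.
Unset Printing Implicit Defensive.

Import Order.TTheory GRing.Theory Num.Theory.

Local Open Scope classical_set_scope.
Local Open Scope ring_scope.

(* 0 if [A] is infinite. *)
Definition card_set (T : choiceType) (A : set T) : nat := #|` fset_set A|.

Definition symmetric_set (G : groupType) (S : set G) : Prop :=
  forall s, S s -> S (s^-1)%g.

(* [group_closed H] says that [H] is a subgroup. *)
Definition generates (G : groupType) (S : set G) : Prop :=
  forall H : {pred G}, group_closed H -> (forall s, S s -> s \in H) ->
  forall x, x \in H.

Definition word_lengths (G : groupType) (S : set G) (x : G) : set nat :=
  [set n | exists g : 'I_n -> G,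
     (forall i, S (g i)) /\ x = (\prod_(i < n) g i)%g].

(* The minimum of [word_lengths S x]; 0 if that set is empty, which does not
   happen when [S] is a symmetric generating set. *)
Definition word_norm (G : groupType) (S : set G) (x : G) : nat :=
  xget 0%N [set n | word_lengths S x n /\
                    forall m, word_lengths S x m -> (n <= m)%N].

Definition word_ball (R : realType) (G : groupType) (S : set G) (r : R) : set G :=
  [set x | (word_norm S x)%:R <= r].

Definition growth_inv (R : realType) (G : groupType) (S : set G) (v : R) : \bar R :=
  ereal_inf [set r%:E | r in [set r : R | v < (card_set (word_ball S r))%:R]].

Definition boundary (G : groupType) (S Omega : set G) : set G :=
  [set x | Omega x /\ exists s, S s /\ ~ Omega (x * s)%g].

Definition mean_length (R : realType) (G : groupType) (S : set G) (r : R) : R :=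
  (card_set (word_ball S r))%:R^-1 *
  \sum_(g \in word_ball S r) ((word_norm S g)%:R : R).

(* Main.v *)
Require Import Defs.
From HB Require Import structures.
From mathcomp Require Import all_boot all_order all_algebra finmap.
From mathcomp Require Import all_classical all_reals ereal.
From mathcomp Require Import zify ring lra.

(** Fix a finite set [Omega] and a finite set [B] of group elements, and count
    in two ways the pairs [(x, g)] in [Omega * B] such that [x * g] lies outside
    [Omega].

    For a fixed [g] of word norm [n], walk from [x] to [x * g] along a word of
    [n] generators.  If [x * g] is outside [Omega], one of the [n] steps leaves
    [Omega], and it starts at a boundary point.  For each of the [n] steps, the
    starting point is a right translate of [x], hence determines [x]; so at most
    [n * |boundary|] points [x] escape ([count_escape_le]).

    For a fixed [x], the translate [x * B] meets [Omega] in at most [|Omega|]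
    points, so at least [|B| - |Omega|] elements [g] of [B] make [x] escape.

    Together, [|Omega| * (|B| - |Omega|) <= |boundary| * sum_(g in B) |g|]
    ([escape_double_count]).  As soon as [(1 + alpha) * |Omega| <= |B|], the
    factor [|B| - |Omega|] is at least [alpha / (1 + alpha) * |B|], and dividing
    gives an isoperimetric inequality with [B] in the role of the ball
    ([isoperimetry_mean_norm]).  When [B] is the ball [B(r)], inserting the factor
    [|B(r - 1)| / |B(r)|] only weakens it, as this factor is at most 1.

    It remains to apply this to the ball of radius [r = growth_inv v].  Since the
    word norm is integer valued, balls only change at integer radii, so the
    infimum defining [r] is attained ([lt_card_ball_growth_inv]) and
    [|B(r)| > v = (1 + alpha) * |Omega|].  The infimum is finite in an infinite
    group because balls are finite and exhaust the group ([growth_inv_lty]). *)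

Set Implicit Arguments.
Unset Strict Implicit.
Unset Printing Implicit Defensive.

Import Order.TTheory GRing.Theory Num.Theory.

Local Open Scope classical_set_scope.
Local Open Scope ring_scope.

(** * Words and word norm *)

Section Words.
Variables (G : groupType) (S : set G).

Lemma word_lengths0 (x : G) : word_lengths S x 0 <-> x = 1%g.
Proof.
split=> [[g [_ ->]]|->]; first by rewrite big_ord0.
by exists (fun _ => 1%g); split=> [[]//|]; rewrite big_ord0.
Qed.

Lemma word_lengthsS (x : G) n : word_lengths S x n.+1 <->
  exists y s, [/\ word_lengths S y n, S s & x = (y * s)%g].
Proof.
split=> [[g [gS ->]]|[y [s [[g [gS ->]] sS ->]]]].
  rewrite big_ord_recr /=; eexists; eexists; split=> //.
  by exists (fun i => g (widen_ord (leqnSn n) i)).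
(* The default [s] is reached exactly at the last index, where [insub] fails. *)
exists (fun i => if insub (i : nat) is Some j then g j else s).
split=> [i|]; first by case: insub.
rewrite big_ord_recr /= insubN ?ltnn//; congr (_ * _)%g.
apply: eq_bigr => i _; case: insubP => [j _ ij|]; last by rewrite ltn_ord.
by congr g; exact/val_inj.
Qed.

Lemma word_lengthsM (x y : G) m n : word_lengths S x m ->
  word_lengths S y n -> word_lengths S (x * y)%g (m + n)%N.
Proof.
move=> xm; elim: n y => [y /word_lengths0 ->|n IHn y /word_lengthsS].
  by rewrite addn0 mulg1.
move=> [z [s [/IHn xzn sS ->]]]; rewrite addnS.
by apply/word_lengthsS; exists (x * z)%g, s; rewrite mulgA.
Qed.

Lemma word_lengths1 (s : G) : S s -> word_lengths S s 1.
Proof.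
move=> sS; apply/word_lengthsS; exists 1%g, s; split=> //; last by rewrite mul1g.
exact/word_lengths0.
Qed.

Lemma word_lengthsV (x : G) n : symmetric_set S ->
  word_lengths S x n -> word_lengths S x^-1%g n.
Proof.
move=> symS; elim: n x => [x /word_lengths0 ->|n IHn x /word_lengthsS].
  by rewrite invg1; exact/word_lengths0.
move=> [y [s [/IHn yn /symS/word_lengths1 s1 ->]]].
by rewrite invgM -add1n; exact: word_lengthsM.
Qed.

(** The elements that are words in [S] form a subgroup containing [S]. *)
Lemma word_lengths_ex : symmetric_set S -> generates S ->
  forall x : G, exists n, word_lengths S x n.
Proof.
move=> symS genS x.
pose H : {pred G} := [pred y | `[< exists n, word_lengths S y n >]].
suff /asboolP : x \in H by [].
apply: genS => [|s sS]; last by apply/asboolP; exists 1%N; exact: word_lengths1.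
split; first by apply/asboolP; exists 0%N; exact/word_lengths0.
move=> y z /asboolP[m ym] /asboolP[n zn]; apply/asboolP; exists (m + n)%N.
exact/word_lengthsM/word_lengthsV.
Qed.

(** The minimum in the definition of the norm is attained, because every element
    is a word. *)
Lemma word_lengths_norm : symmetric_set S -> generates S ->
  forall x : G, word_lengths S x (word_norm S x).
Proof.
move=> symS genS x.
have [n xn] := word_lengths_ex symS genS x.
suff : exists k, word_lengths S x k /\ forall m, word_lengths S x m -> (k <= m)%N.
  by move=> /(@xgetPex _ 0%N)[].
have exP : exists k, `[< word_lengths S x k >] by exists n; exact/asboolP.
exists (ex_minn exP); case: ex_minnP => k /asboolP xk kmin.
by split=> // m /asboolP; exact: kmin.
Qed.

Lemma finite_word_lengths n : finite_set S ->
  finite_set [set x : G | word_lengths S x n].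
Proof.
move=> finS; elim: n => [|n IHn].
  by apply: sub_finite_set (finite_set1 (1%g : G)) => x /word_lengths0.
apply: sub_finite_set (finite_image2 (fun y s : G => (y * s)%g) IHn finS).
by move=> x /word_lengthsS[y [s [yn sS ->]]]; exists y => //; exists s.
Qed.

End Words.

(** * Counting escapes from a finite set *)

Section Escape.
Variables (G : groupType) (S : set G).

Lemma count_translate_le (A B : seq G) (f : G -> G) :
  injective f -> uniq A -> (count (fun x => f x \in B) A <= size B)%N.
Proof.
move=> injf uA; rewrite -size_filter -(size_map f).
apply: uniq_leq_size; first by rewrite map_inj_uniq// filter_uniq.
by move=> _ /mapP[x + ->]; rewrite mem_filter => /andP[].
Qed.

(** Induction on a word for [g]: if [x * (h * s)] is outside [A], then either
    [x * h] already is, or [x * h] is one of the boundary points in [D], which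
    happens for at most [size D] points [x]. *)
Lemma count_escape_le (A D : seq G) (g : G) n :
  uniq A -> (forall x s, x \in A -> S s -> (x * s)%g \notin A -> x \in D) ->
  word_lengths S g n ->
  (count (fun x => (x * g)%g \notin A) A <= n * size D)%N.
Proof.
move=> uA AD; elim: n g => [g /word_lengths0 ->|n IHn g /word_lengthsS].
  rewrite leqn0 -(count_pred0 A); apply/eqP/eq_in_count => x xA.
  by rewrite mulg1 xA.
move=> [h [s [/IHn hn sS ->]]]; rewrite mulSnr.
apply: leq_trans (leq_add hn (count_translate_le D (@mulIg _ h) uA)).
rewrite -count_predUI; apply: leq_trans (leq_addr _ _).
apply: sub_count => x /=; rewrite mulgA => xhsA.
by case: (boolP ((x * h)%g \in A)) => //= xhA; exact: AD xhsA.
Qed.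

(** Both sides bound the number [E] of pairs [(x, g)] with [x * g] outside [A]:
    it is summed over [g] first for the lower bound, over [x] first for the upper
    one. *)
Lemma escape_double_count (A B D : seq G) (norm : G -> nat) :
  uniq A -> uniq B ->
  (forall x s, x \in A -> S s -> (x * s)%g \notin A -> x \in D) ->
  (forall g, word_lengths S g (norm g)) ->
  (size A * (size B - size A) <= (\sum_(g <- B) norm g) * size D)%N.
Proof.
move=> uA uB AD normP.
pose E := (\sum_(x <- A) \sum_(g <- B) ((x * g)%g \notin A : nat))%N.
have sum_count (s : seq G) (a : pred G) : (\sum_(x <- s) (a x : nat) = count a s)%N.
  by rewrite -sum1_count [RHS]big_mkcond; apply: eq_bigr => x _; case: (a x).
apply: (@leq_trans E).
  rewrite mulnC -iter_addn_0 -(count_predT A) -big_const_seq.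
  apply: leq_sum => x _; rewrite sum_count leq_subLR.
  rewrite -(count_predC (fun g => (x * g)%g \in A)) leq_add2r.
  exact: count_translate_le (@mulgI _ x) uB.
rewrite /E exchange_big big_distrl; apply: leq_sum => g _.
by rewrite sum_count; exact: count_escape_le.
Qed.

End Escape.

(** * The isoperimetric inequality for an arbitrary finite set of translations *)

Section Isoperimetry.
Variables (R : realType) (G : groupType) (S : set G).

Lemma isoperimetry_mean_norm (alpha : R) (Omega B : set G) :
  symmetric_set S -> generates S -> 0 <= alpha ->
  finite_set Omega -> Omega !=set0 -> finite_set B ->
  (1 + alpha) * (card_set Omega)%:R <= (card_set B)%:R ->
  alpha / (1 + alpha) *
    (1 / ((card_set B)%:R^-1 * \sum_(g \in B) ((word_norm S g)%:R : R))) <=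
  (card_set (boundary S Omega))%:R / (card_set Omega)%:R.
Proof.
move=> symS genS alpha_ge0 finO [o Oo] finB le_OB.
have finD : finite_set (boundary S Omega) by apply: sub_finite_set finO => x [].
pose W := (\sum_(g <- fset_set B) word_norm S g)%N.
have -> : \sum_(g \in B) ((word_norm S g)%:R : R) = W%:R.
  by rewrite fsbig_finite//= natr_sum.
have O_gt0 : (0 < card_set Omega)%N.
  by rewrite cardfs_gt0; apply/fset0Pn; exists o; rewrite in_fset_set// inE.
have : (card_set Omega * (card_set B - card_set Omega) <=
        W * card_set (boundary S Omega))%N.
  apply: escape_double_count (fset_uniq _) (fset_uniq _) _
    (word_lengths_norm symS genS) => x s.
  rewrite !in_fset_set// !inE => Ox sS xsO.
  by split=> //; exists s; split=> // /mem_set; exact/negP.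
rewrite -(@ler_nat R) !natrM.
set o_ := (card_set Omega)%:R in le_OB *; set b := (card_set B)%:R in le_OB *.
set d := (card_set (boundary S Omega))%:R => double_count.
have o_pos : 0 < o_ :> R by rewrite ltr0n.
have b_pos : 0 < b :> R by nra.
(* If all norms in [B] vanish, the left-hand side is 0 since [0^-1 = 0]. *)
have [->|W_neq0] := eqVneq W 0%N.
  by rewrite mulr0 invr0 !mulr0 divr_ge0.
have W_pos : 0 < W%:R :> R by rewrite ltr0n lt0n.
have le_diff : b - o_ <= (card_set B - card_set Omega)%N%:R :> R.
  by rewrite lerBlDr -natrD ler_nat; lia.
have -> : alpha / (1 + alpha) * (1 / (b^-1 * W%:R)) =
    alpha * b / ((1 + alpha) * W%:R).
  by field; rewrite !lt0r_neq0//; lra.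
rewrite ler_pdivrMr ?mulr_gt0//; last lra.
rewrite mulrAC ler_pdivlMr//.
(* The constant [alpha / (1 + alpha)] comes from here: it is the proportion of
   [B] that remains after removing [|Omega| <= |B| / (1 + alpha)] elements. *)
have le_alpha_b : alpha * b <= (1 + alpha) * (b - o_) by lra.
apply: le_trans (_ : (1 + alpha) * (b - o_) * o_ <= _).
  by rewrite ler_wpM2r// ltW.
have -> : (1 + alpha) * (b - o_) * o_ = (1 + alpha) * (o_ * (b - o_)) by ring.
have -> : d * ((1 + alpha) * W%:R) = (1 + alpha) * (W%:R * d) by ring.
rewrite ler_wpM2l ?addr_ge0//; apply: le_trans double_count.
by rewrite ler_wpM2l// ltW.
Qed.

End Isoperimetry.

(** * Balls and the generalized inverse of the growth function *)

Section Growth.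
Variables (R : realType) (G : groupType) (S : set G).

Lemma word_ball_truncn (r : R) : 0 <= r ->
  word_ball S ((Num.truncn r)%:R : R) = word_ball S r.
Proof.
move=> r_ge0; apply/seteqP; split=> x; rewrite /word_ball /= ler_nat truncn_ge_nat//.
Qed.

(** An attained infimum: rounding a radius down to an integer does not change the
    ball, so the radii [r] with [|B(r)| > v] have the least natural number among
    them as their minimum.  Negative radii are excluded by [0 <= v]. *)
Lemma lt_card_ball_growth_inv (v : R) : 0 <= v -> (growth_inv S v < +oo)%E ->
  v < (card_set (word_ball S (fine (growth_inv S v))))%:R.
Proof.
move=> v_ge0 /ereal_inf_lt[_ [r0 vr0 _] _].
have large_ge0 (r : R) : v < (card_set (word_ball S r))%:R -> 0 <= r.
  move=> vr; rewrite leNgt; apply/negP => r_lt0; move: vr.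
  rewrite ltNge => /negP; apply; rewrite (_ : word_ball S r = set0).
    by rewrite /card_set fset_set0 cardfs0.
  apply/seteqP; split=> x //=; rewrite /word_ball /= => xr.
  by have := le_lt_trans xr r_lt0; rewrite ltrn0.
have large_truncn (r : R) : v < (card_set (word_ball S r))%:R ->
    v < (card_set (word_ball S ((Num.truncn r)%:R : R)))%:R.
  by move=> vr; rewrite word_ball_truncn// large_ge0.
have exN : exists n, v < (card_set (word_ball S (n%:R : R)))%:R.
  by exists (Num.truncn r0); exact: large_truncn.
have [N vN Nmin] := ex_minnP exN.
suff -> : growth_inv S v = N%:R%:E by [].
apply/eqP; rewrite eq_le; apply/andP; split.
  by apply: ereal_inf_lbound; exists N%:R.
apply: le_ereal_inf_tmp => _ [r vr <-]; rewrite lee_fin.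
by rewrite -truncn_ge_nat ?large_ge0//; exact/Nmin/large_truncn.
Qed.

Lemma finite_word_ball (r : R) : finite_set S -> symmetric_set S ->
  generates S -> finite_set (word_ball S r).
Proof.
move=> finS symS genS.
apply: sub_finite_set (bigcup_finite (finite_II (Num.truncn r).+1)
  (fun n _ => finite_word_lengths n finS)) => x xr.
have r_ge0 : 0 <= r by exact: le_trans (ler0n _ _) xr.
exists (word_norm S x); last exact: word_lengths_norm.
by rewrite /= ltnS truncn_ge_nat.
Qed.

(** An infinite group has finite subsets of every size, and each of them lies
    in a ball. *)
Lemma growth_inv_lty (v : R) : finite_set S -> symmetric_set S ->
  generates S -> infinite_set [set: G] -> (growth_inv S v < +oo)%E.
Proof.
move=> finS symS genS infG.
have [F _ leF] := infinite_set_fset (Num.truncn v).+1 infG.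
pose n := (\max_(g <- F) word_norm S g)%N.
have FB : (F `<=` fset_set (word_ball S (n%:R : R)))%fset.
  apply/fsubsetP => g gF; rewrite in_fset_set ?inE; last exact: finite_word_ball.
  by rewrite /word_ball /= ler_nat; exact: leq_bigmax_seq.
apply: (@le_lt_trans _ _ n%:R%:E); last exact: ltry.
apply: ereal_inf_lbound; exists n%:R => //=.
apply: lt_le_trans (_ : v < (Num.truncn v).+1%:R) _.
  exact/real_truncnS_gt/num_real.
by rewrite ler_nat; exact: leq_trans leF (fsubset_leq_card FB).
Qed.

End Growth.

(** * The inequality at the radius given by the growth function *)

Theorem theorem3p1 (R : realType) (G : groupType) (S : set G)
    (finS : finite_set S) (symS : symmetric_set S) (genS : generates S)
    (alpha : R) (alpha_ge0 : 0 <= alpha)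
    (Omega : set G) (finO : finite_set Omega) (O_neq0 : Omega !=set0) :
  let Phi := growth_inv S ((1 + alpha) * (card_set Omega)%:R) in
  let r := fine Phi in
  (infinite_set [set: G] -> (Phi < +oo)%E) /\
  ((Phi < +oo)%E ->
   (card_set (boundary S Omega))%:R / (card_set Omega)%:R >=
   alpha / (1 + alpha) *
   ((card_set (word_ball S (r - 1)))%:R / (card_set (word_ball S r))%:R) *
   (1 / mean_length S r)).
Proof.
move=> Phi r; split=> [|Phi_lty]; first exact: growth_inv_lty.
have v_ge0 : 0 <= (1 + alpha) * (card_set Omega)%:R.
  by rewrite mulr_ge0// addr_ge0.
have lt_vB : (1 + alpha) * (card_set Omega)%:R < (card_set (word_ball S r))%:R.
  exact: lt_card_ball_growth_inv.
have finB (q : R) : finite_set (word_ball S q) by exact: finite_word_ball.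
apply: le_trans (isoperimetry_mean_norm symS genS alpha_ge0 finO O_neq0
  (finB r) (ltW lt_vB)).
have mean_ge0 : 0 <= mean_length S r.
  rewrite /mean_length mulr_ge0 ?invr_ge0// fsbig_finite//=.
  by apply: sumr_ge0.
rewrite -/(mean_length S r) ler_wpM2r ?divr_ge0//.
rewrite ler_piMr ?divr_ge0 ?addr_ge0//.
rewrite ler_pdivrMr ?mul1r; last exact: le_lt_trans lt_vB.
rewrite ler_nat; apply: fsubset_leq_card; rewrite -fset_set_sub//.
move=> x; rewrite /word_ball /= => /le_trans; apply.
by rewrite gerBl.
Qed.
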